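(* Let $\mathcal{A}\in\mathbb{C}^{n\times n}$, $\mathcal{B}\in\mathbb{C}^{n\times m_2}$, $\mathcal{C}\in\mathbb{C}^{m_1\times n}$ be such that $\varphi(z)=\mathcal{C}(zI_n-\mathcal{A})^{-1}\mathcal{B}$ is a minimal realization of a strictly proper rational $m_1\times m_2$ matrix function, and let $\{\alpha,S_0,\vartheta_1,\vartheta_2\}$ be the quadruple recovered from $\{\mathcal{A},\mathcal{B},\mathcal{C}\}$ (by the recovery procedure described in the context). This recovery is stable, that is, for every $\varepsilon>0$ there is a $\delta>0$ such that for every triple $\{\widetilde{\mathcal{A}},\widetilde{\mathcal{B}},\widetilde{\mathcal{C}}\}$ of matrices of the same respective sizes, giving a minimal realization $\widetilde\varphi(z)=\widetilde{\mathcal{C}}(zI_n-\widetilde{\mathcal{A}})^{-1}\widetilde{\mathcal{B}}$, the inequality $$\|\mathcal{A}-\widetilde{\mathcal{A}}\|+\|\mathcal{B}-\widetilde{\mathcal{B}}\|+\|\mathcal{C}-\widetilde{\mathcal{C}}\|<\delta$$ yields the inequality $$\|\alpha-\widetilde\alpha\|+\|S_0-\widetilde S_0\|+\|\vartheta_1-\widetilde\vartheta_1\|+\|\vartheta_2-\widetilde\vartheta_2\|<\varepsilon,$$ where $\{\widetilde\alpha,\widetilde S_0,\widetilde\vartheta_1,\widetilde\vartheta_2\}$ is the quadruple recovered from $\{\widetilde{\mathcal{A}},\widetilde{\mathcal{B}},\widetilde{\mathcal{C}}\}$ by the same procedure.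
   Context: $\|\cdot\|$ is the $\ell^2$-induced matrix norm. $X>0$ means that $X$ is Hermitian with all eigenvalues positive. A rational matrix function is strictly proper if it tends to zero at infinity. A realization $\varphi(z)=\mathcal{C}(zI_n-\mathcal{A})^{-1}\mathcal{B}$ is minimal if $n$ is minimal among all possible realizations of $\varphi$; equivalently, $\mathrm{span}\bigcup_{k=0}^{n-1}\mathrm{Im}(\mathcal{A}^k\mathcal{B})=\mathbb{C}^n$ (controllability of $\{\mathcal{A},\mathcal{B}\}$) and $\mathrm{span}\bigcup_{k=0}^{n-1}\mathrm{Im}((\mathcal{A}^* )^k\mathcal{C}^* )=\mathbb{C}^n$ (observability of $\{\mathcal{C},\mathcal{A}\}$). Recovery procedure (discrete case): given a minimal realization, let $X>0$ be the positive solution (it exists and is unique, by known results) of the Riccati equation $$X\mathcal{C}^*\mathcal{C}X-\mathrm{i}(\mathcal{A}X-X\mathcal{A}^* )-\mathcal{B}\mathcal{B}^*=0,$$ and put $$\alpha=-\mathcal{A}+\mathrm{i}\,\mathcal{B}\mathcal{B}^*X^{-1},\quad S_0=X,\quad \vartheta_1=X\mathcal{C}^*,\quad \vartheta_2=\mathrm{i}\mathcal{B}.$$ *)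

(* Defs.v *)
From mathcomp Require Import all_boot all_order all_algebra.
From mathcomp Require Import complex.
From mathcomp Require Import all_classical all_reals.

Set Implicit Arguments.
Unset Strict Implicit.
Unset Printing Implicit Defensive.

Import Order.TTheory GRing.Theory Num.Theory.

Local Open Scope ring_scope.
Local Open Scope classical_set_scope.
Local Open Scope sesquilinear_scope.

Section Norms.
Variable R : realType.

Definition l2norm n (x : 'cV[R[i]]_n) : R :=
  Num.sqrt (\sum_i Normc.normc (x i 0) ^+ 2).

Definition opnorm m n (M : 'M[R[i]]_(m, n)) : R :=
  sup [set l2norm (M *m x) | x in [set x : 'cV_n | l2norm x <= 1]].

(* [eigenvalue] takes values in [R[i]], where [0 < a] means that [a] is real
   and positive. *)
Definition posdefmx n (X : 'M[R[i]]_n) : Prop :=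
  X \is hermsymmx /\ forall a, eigenvalue X a -> 0 < a.

End Norms.

Section Realizations.
Variable R : realType.

(* Rational functions are elements of the fraction field of R[i][z], so that
   equality of rational matrix functions ignores removable singularities. *)
Definition ratfun := {fraction {poly R[i]}}.

Definition ratmx m1 m2 := 'M[ratfun]_(m1, m2).

Definition constmx m n (M : 'M[R[i]]_(m, n)) : ratmx m n :=
  map_mx (fun c => tofrac c%:P) M.

(* [char_poly_mx A] is zI - A; its determinant is a monic polynomial, hence it
   is invertible over the field of rational functions. *)
Definition transfer n m1 m2 (A : 'M[R[i]]_n) (B : 'M[R[i]]_(n, m2))
    (C : 'M[R[i]]_(m1, n)) : ratmx m1 m2 :=
  constmx C *m invmx (map_mx (@tofrac _) (char_poly_mx A)) *m constmx B.

(* The value at z is meaningful away from the finitely many zeros of the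
   denominator of the chosen representative of f. *)
Definition ratfun_eval (f : ratfun) (z : R[i]) : R[i] :=
  (\n_(repr f)).[z] / (\d_(repr f)).[z].

Definition strictly_proper m1 m2 (phi : ratmx m1 m2) : Prop :=
  forall eps : R, 0 < eps -> exists r : R, forall z : R[i],
    r < Normc.normc z -> opnorm (map_mx (fun f => ratfun_eval f z) phi) < eps.

Definition realization m1 m2 (phi : ratmx m1 m2) n (A : 'M[R[i]]_n)
    (B : 'M[R[i]]_(n, m2)) (C : 'M[R[i]]_(m1, n)) : Prop :=
  phi = transfer A B C.

Definition minimal_realization m1 m2 (phi : ratmx m1 m2) n (A : 'M[R[i]]_n)
    (B : 'M[R[i]]_(n, m2)) (C : 'M[R[i]]_(m1, n)) : Prop :=
  realization phi A B C /\
  forall k (A' : 'M[R[i]]_k) (B' : 'M[R[i]]_(k, m2)) (C' : 'M[R[i]]_(m1, k)),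
    realization phi A' B' C' -> (n <= k)%N.

End Realizations.

Section Recovery.
Variables (R : realType) (n m1 m2 : nat).
Variables (A : 'M[R[i]]_n) (B : 'M[R[i]]_(n, m2)) (C : 'M[R[i]]_(m1, n)).

Definition riccati (X : 'M[R[i]]_n) : Prop :=
  X *m C^t* *m C *m X - 'i *: (A *m X - X *m A^t*) - B *m B^t* = 0.

(* The positive solution of the Riccati equation; for a minimal realization it
   exists and is unique, so the default value 0 is irrelevant. *)
Definition riccati_sol : 'M[R[i]]_n :=
  xget 0 [set X | posdefmx X /\ riccati X].

Definition rec_alpha : 'M[R[i]]_n :=
  - A + 'i *: (B *m B^t* *m invmx riccati_sol).
Definition rec_S0 : 'M[R[i]]_n := riccati_sol.
Definition rec_theta1 : 'M[R[i]]_(n, m1) := riccati_sol *m C^t*.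
Definition rec_theta2 : 'M[R[i]]_(n, m2) := 'i *: B.

End Recovery.

(* Main.v *)
Require Import Defs.
From mathcomp Require Import all_boot all_order all_algebra.
From mathcomp Require Import complex.
From mathcomp Require Import all_classical all_reals.
From mathcomp Require Import topology normedtype sequences realfun.
From mathcomp Require Import ring lra.

Set Implicit Arguments.
Unset Strict Implicit.
Unset Printing Implicit Defensive.

Import Order.TTheory GRing.Theory Num.Theory.
Import numFieldNormedType.Exports.

Local Open Scope ring_scope.
Local Open Scope sesquilinear_scope.

(** With F = iA, P = BB* and Q = C*C the Riccati equation reads ric X = 0, where
    ric X = FX + XF* - XQX + P. Everything rests on a comparison principle: if
    (F, P) is controllable, S > 0 and ric S <= 0 <= ric T, then T <= S, because
    Z = S - T solves a Lyapunov equation for the stable matrix F - SQ. Existence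
    of a positive solution: observability yields a supersolution, and the
    Newton-Kleinman iteration decreases from it to a solution. Stability: if Z solves (F - XQ)Z + Z(F - XQ)* = -1, then X + tZ and
    X - tZ are a strict super- and a strict subsolution for small t > 0; they
    remain so for nearby data, so they enclose any solution for these data. *)

(* [ring] does not apply to matrices: the expanded products are abstracted and
   the identity, now linear, is checked entrywise. *)
Ltac mxring :=
  rewrite ?(mulmxBl, mulmxBr, mulmxDl, mulmxDr, mulNmx, mulmxN) ?mulmxA
    -?scalemxAl -?scalemxAr -?scalemxAl -?scalemxAr;
  repeat match goal with |- context [@mulmx ?S ?m ?n ?p ?A ?B] =>
    move: (@mulmx S m n p A B) => ? end;
  apply/matrixP => ? ?; rewrite !mxE; ring.

(** * Nonnegative matrices *)

(** No spectrum enters the comparison: that a matrix [G] is stable is never stated, but certified by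
    an equation [G X + X G^t* = - V] with [X] and [V] nonnegative and the pair of [G] and [V]
    controllable. For the closed loop [F - S Q] of a supersolution [S], the matrix [S] itself is
    such a certificate. An implicit function argument would continue [X] along a branch of
    solutions, but would leave open whether the positive solution selected for nearby data lies on
    that branch. The enclosure between a sub- and a supersolution holds for every nonnegative
    solution, hence for the one that [xget] selects. Minimality is used through kernels only:
    observability makes the supersolution possible, controllability drives the comparison and makes
    solutions invertible. *)

Section Adjoint.
Context {K : numClosedFieldType}.

Lemma adjmxM m n p (A : 'M[K]_(m, n)) (B : 'M_(n, p)) :
  (A *m B)^t* = B^t* *m A^t*.
Proof. by rewrite trmx_mul map_mxM. Qed.

Lemma adjmxD m n (A B : 'M[K]_(m, n)) : (A + B)^t* = A^t* + B^t*.
Proof. by rewrite linearD /= map_mxD. Qed.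

Lemma adjmxN m n (A : 'M[K]_(m, n)) : (- A)^t* = - A^t*.
Proof. by rewrite linearN /= map_mxN. Qed.

Lemma adjmxB m n (A B : 'M[K]_(m, n)) : (A - B)^t* = A^t* - B^t*.
Proof. by rewrite adjmxD adjmxN. Qed.

Lemma adjmxZ m n a (A : 'M[K]_(m, n)) : (a *: A)^t* = a^* *: A^t*.
Proof. by rewrite linearZ /= map_mxZ. Qed.

Lemma adjmx1 n : (1%:M : 'M[K]_n)^t* = 1%:M.
Proof. by rewrite trmx1 map_mx1. Qed.

Lemma adjmx0 m n : (0 : 'M[K]_(m, n))^t* = 0.
Proof. by rewrite trmx0 map_mx0. Qed.

Lemma adjmx_delta m n i j : (delta_mx i j : 'M[K]_(m, n))^t* = delta_mx j i.
Proof.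
by apply/matrixP=> a b; rewrite !mxE andbC; case: (_ && _); rewrite ?conjC1 ?conjC0.
Qed.

Definition adjE := (adjmxM, adjmxB, adjmxD, adjmxN, adjmx1, @trmxCK K).

Lemma hermsymmxP n (X : 'M[K]_n) : reflect (X^t* = X) (X \is hermsymmx).
Proof.
rewrite is_hermitianmxE expr0 scale1r.
by apply: (iffP eqP) => /esym.
Qed.

Lemma spectral_decomposition n (X : 'M[K]_n) : X^t* = X ->
  exists (U : 'M_n) (d : 'rV_n), [/\ U *m U^t* = 1%:M, U^t* *m U = 1%:M,
    X = U^t* *m diag_mx d *m U & forall i, d 0 i \is Num.real].
Proof.
move=> /hermsymmxP hX.
have uU := spectral_unitarymx X.
exists (spectralmx X), (spectral_diag X); split.
- exact/unitarymxP.
- by rewrite -{1}invmx_unitary // mulVmx // unitarymx_unit.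
- by rewrite -invmx_unitary //; apply/orthomx_spectralP/hermitian_normalmx.
- by move=> i; have /mxOverP := hermitian_spectral_diag_real hX; apply.
Qed.

Definition quadform n (X : 'M[K]_n) (u : 'cV_n) : K := (u^t* *m X *m u) 0 0.

Lemma quadformD n (X Y : 'M[K]_n) u : quadform (X + Y) u = quadform X u + quadform Y u.
Proof. by rewrite /quadform mulmxDr mulmxDl mxE. Qed.

Lemma quadformN n (X : 'M[K]_n) u : quadform (- X) u = - quadform X u.
Proof. by rewrite /quadform mulmxN mulNmx mxE. Qed.

Lemma quadformZ n a (X : 'M[K]_n) u : quadform (a *: X) u = a * quadform X u.
Proof. by rewrite /quadform -scalemxAr -scalemxAl mxE. Qed.

Lemma quadformM n m (X : 'M[K]_n) (M : 'M_(n, m)) u :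
  quadform (M^t* *m X *m M) u = quadform X (M *m u).
Proof. by rewrite /quadform adjmxM !mulmxA. Qed.

Lemma quadform1 n (u : 'cV[K]_n) : quadform 1%:M u = \sum_i `|u i 0| ^+ 2.
Proof.
rewrite /quadform mulmx1 mxE; apply: eq_bigr => i _.
by rewrite !mxE normCKC.
Qed.

Lemma quadform1_ge0 n (u : 'cV[K]_n) : 0 <= quadform 1%:M u.
Proof. by rewrite quadform1 sumr_ge0 // => i _; rewrite exprn_ge0. Qed.

Lemma quadform1_eq0 n (u : 'cV[K]_n) : quadform 1%:M u = 0 -> u = 0.
Proof.
rewrite quadform1 => /eqP; rewrite psumr_eq0 => [/allP H|i _]; last exact: exprn_ge0.
apply/matrixP=> i j; rewrite ord1 !mxE; apply/eqP.
by have := H i (mem_index_enum _); rewrite /= expf_eq0 /= normr_eq0.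
Qed.

Lemma quadformDZ n (X : 'M[K]_n) u c v : quadform X (u + c *: v) =
  quadform X u + c * (u^t* *m X *m v) 0 0 + c^* * (v^t* *m X *m u) 0 0
  + c * c^* * quadform X v.
Proof.
rewrite /quadform adjmxD adjmxZ !mulmxDl !mulmxDr -!scalemxAl -!scalemxAr.
move: (u^t* *m X *m u) (u^t* *m X *m v) (v^t* *m X *m u) (v^t* *m X *m v).
by move=> a b d e; rewrite !mxE; ring.
Qed.

(** It takes an arbitrary function [q] because it is also applied to pointwise limits of forms,
    before these are known to be forms. *)
Definition polarization n (q : 'cV[K]_n -> K) i j : K :=
  let e k := delta_mx k 0 in
  (q (e i + 1 *: e j) - 'i * q (e i + 'i *: e j) - (1 - 'i) * (q (e i) + q (e j))) / 2.

Lemma polarizationE n (X : 'M[K]_n) i j : polarization (quadform X) i j = X i j.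
Proof.
rewrite /polarization !quadformDZ conjCi conjC1 !adjmx_delta -!rowE -!colE !mxE.
by field: (sqrCi K).
Qed.

Definition psd n (X : 'M[K]_n) : Prop := X^t* = X /\ forall u, 0 <= quadform X u.

Lemma psd1 n : psd (1%:M : 'M[K]_n).
Proof. by split=> [|u]; rewrite ?adjmx1 ?quadform1_ge0. Qed.

Lemma psd0 n : psd (0 : 'M[K]_n).
Proof. by split=> [|u]; rewrite ?adjmx0 // /quadform mulmx0 mul0mx mxE. Qed.

Lemma psdD n (X Y : 'M[K]_n) : psd X -> psd Y -> psd (X + Y).
Proof.
move=> [hX pX] [hY pY]; split=> [|u]; first by rewrite adjmxD hX hY.
by rewrite quadformD addr_ge0.
Qed.

Lemma psdZ n a (X : 'M[K]_n) : 0 <= a -> psd X -> psd (a *: X).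
Proof.
move=> a0 [hX pX]; split=> [|u].
  by rewrite adjmxZ hX; congr (_ *: _); apply/CrealP/ger0_real.
by rewrite quadformZ mulr_ge0.
Qed.

Lemma psd_congr n m (X : 'M[K]_n) (M : 'M_(n, m)) :
  psd X -> psd (M^t* *m X *m M).
Proof.
move=> [hX pX]; split=> [|u]; first by rewrite !adjE hX mulmxA.
by rewrite quadformM.
Qed.

Lemma psd_gram n m (M : 'M[K]_(n, m)) : psd (M^t* *m M).
Proof. by have := psd_congr M (psd1 n); rewrite mulmx1. Qed.

Lemma psd_factor n (X : 'M[K]_n) : psd X -> exists S : 'M_n, X = S *m S^t*.
Proof.
move=> [hX pX]; have [U [d [UU UU' eX dr]]] := spectral_decomposition hX.
have d0 i : 0 <= d 0 i.
  (* [d 0 i] is the value of the form at the [i]-th column of [U^t*]. *)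
  have := pX (U^t* *m delta_mx i 0); rewrite -quadformM !adjE eX.
  rewrite !mulmxA UU mul1mx -mulmxA UU mulmx1 /quadform.
  by rewrite adjmx_delta -rowE -colE !mxE eqxx mulr1n.
exists (U^t* *m diag_mx (map_mx sqrtC d)).
rewrite !adjE eX -!mulmxA; congr (_ *m _); rewrite mulmxA; congr (_ *m _).
rewrite tr_diag_mx map_diag_mx mulmx_diag; congr diag_mx.
apply/matrixP=> i j; rewrite ord1 !mxE.
have s0 : 0 <= sqrtC (d 0 j) by rewrite sqrtC_ge0.
by rewrite [X in _ * X](CrealP (ger0_real s0)) -expr2 sqrtCK.
Qed.

(** For [X = S S^t*] the form at [u] is the squared norm of [S^t* u]. *)
Lemma psd_ker n (X : 'M[K]_n) (u : 'cV_n) : psd X -> quadform X u = 0 -> X *m u = 0.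
Proof.
move=> /psd_factor[S ->]; rewrite -{1}(mulmx1 S) -{1}(trmxCK S) quadformM.
by move=> /quadform1_eq0 Su; rewrite -mulmxA Su mulmx0.
Qed.

Lemma quadform_ker n (X : 'M[K]_n) (u : 'cV_n) : X *m u = 0 -> quadform X u = 0.
Proof. by move=> Xu; rewrite /quadform -mulmxA Xu mulmx0 mxE. Qed.

Lemma psdD_ker n (X Y : 'M[K]_n) (u : 'cV_n) : psd X -> psd Y ->
  (X + Y) *m u = 0 -> X *m u = 0 /\ Y *m u = 0.
Proof.
move=> pX pY /quadform_ker/eqP; rewrite quadformD paddr_eq0 ?pX.2 ?pY.2 //.
by move=> /andP[/eqP ? /eqP ?]; split; apply: psd_ker.
Qed.

Lemma psdZ_ker n a (X : 'M[K]_n) (u : 'cV_n) : a != 0 -> (a *: X) *m u = 0 -> X *m u = 0.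
Proof.
move=> a0; rewrite -scalemxAl => /(congr1 ( *:%R a^-1)).
by rewrite scalerA mulVf // scale1r scaler0.
Qed.

Lemma gram_ker n m (M : 'M[K]_(n, m)) (u : 'cV_m) : (M^t* *m M) *m u = 0 -> M *m u = 0.
Proof.
move=> /quadform_ker; rewrite -[M in _ *m M]mul1mx mulmxA quadformM.
exact: quadform1_eq0.
Qed.

Lemma cV_eq0_mx n m (X : 'M[K]_(m, n)) : (forall u : 'cV_n, X *m u = 0) -> X = 0.
Proof.
by move=> X0; apply/matrixP=> i j; have := X0 (delta_mx j 0);
  rewrite -colE => /matrixP/(_ i 0); rewrite !mxE.
Qed.

Lemma psd_antisym n (X : 'M[K]_n) : psd X -> psd (- X) -> X = 0.
Proof.
move=> pX pNX; apply: cV_eq0_mx => u.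
apply: (psd_ker pX); apply/eqP; rewrite eq_le pX.2 andbT.
by rewrite -oppr_ge0 -quadformN pNX.2.
Qed.

Lemma unitmx_ker0 n (X : 'M[K]_n) (u : 'cV_n) : X \in unitmx -> X *m u = 0 -> u = 0.
Proof. by move=> uX /(congr1 (mulmx (invmx X))); rewrite mulKmx // mulmx0. Qed.

Lemma ker0_unitmx n (X : 'M[K]_n) : (forall u : 'cV_n, X *m u = 0 -> u = 0) -> X \in unitmx.
Proof.
move=> X0; rewrite -unitmx_tr -row_free_unit; apply: inj_row_free => v vX.
apply: trmx_inj; rewrite trmx0; apply: X0.
by rewrite -[X]trmxK -trmx_mul vX trmx0.
Qed.

(** Inclusion of row spaces can be tested on [cokermx X], whose columns lie in the kernel of [X].
    This turns kernel conditions, as in [controllable], into the factorizations that reduce a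
    realization. *)
Lemma factor_ker n m p (X : 'M[K]_(n, p)) (M : 'M_(m, p)) :
  (forall u : 'cV_p, X *m u = 0 -> M *m u = 0) -> exists E, M = E *m X.
Proof.
move=> XM; suff /submxP[E ->] : (M <= X)%MS by exists E.
rewrite submxE; apply/eqP/cV_eq0_mx => u.
by rewrite -mulmxA; apply: XM; rewrite mulmxA mulmx_coker mul0mx.
Qed.

(** With [X = S S^t*], the number [l] is the least eigenvalue of [Y], the congruence of [Z] by the
    inverse of [S]. For [n = 0] there is no eigenvalue, and the empty matrix is invertible. *)
Lemma psd_pencil n (X Z : 'M[K]_n) : psd X -> X \in unitmx -> Z^t* = Z ->
  exists l : K, [/\ l \is Num.real, psd (Z - l *: X) &
    ((0 < n)%N -> Z - l *: X \notin unitmx)].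
Proof.
case: n X Z => [|n] X Z pX uX hZ.
  exists 0; split=> //; rewrite (_ : _ - _ = 0); first exact: psd0.
  by apply/matrixP => -[].
have [S eX] := psd_factor pX.
have uS : S \in unitmx by move: uX; rewrite eX unitmx_mul => /andP[].
have uS' : S^t* \in unitmx by move: uX; rewrite eX unitmx_mul => /andP[].
pose Y := invmx S *m Z *m invmx (S^t*).
have invS : (invmx S)^t* = invmx (S^t*).
  by rewrite trmx_inv map_invmx.
have hY : Y^t* = Y by rewrite /Y !adjE hZ -invS trmxCK mulmxA invS.
have [U [d [UU UU' eY dr]]] := spectral_decomposition hY.
case: (@real_arg_minP _ _ ord0 predT (fun i => d 0 i)) => // i0 _ mini.
exists (d 0 i0); split => [//||_].
  have -> : Z - d 0 i0 *: X =
      (U *m S^t*)^t* *m diag_mx (d - const_mx (d 0 i0)) *m (U *m S^t*).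
    rewrite linearB /= mulmxBr mulmxBl diag_const_mx; congr (_ - _).
      rewrite !adjE !mulmxA -[S *m _ *m _]mulmxA -[S *m (_ *m _) *m _]mulmxA -eY /Y.
      by rewrite !mulmxA mulmxV // mul1mx mulmxKV.
    rewrite mul_mx_scalar -scalemxAl !adjE eX; congr (_ *: _).
    by rewrite -!mulmxA [U^t* *m _]mulmxA UU' mul1mx.
  apply: psd_congr; split=> [|u].
    rewrite tr_diag_mx map_diag_mx; congr diag_mx; apply/matrixP=> a b.
    by rewrite ord1 !mxE rmorphB; congr (_ - _); apply/CrealP.
  rewrite /quadform -mulmxA mxE sumr_ge0 // => i _; rewrite mul_diag_mx !mxE.
  by rewrite mulrCA -normCKC mulr_ge0 ?exprn_ge0 // subr_ge0 mini.
apply/negP => uZ.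
(* An eigenvector of [Y] for [d 0 i0], carried back by the congruence, is killed by [Z - l X]. *)
have : invmx (S^t*) *m U^t* *m delta_mx i0 0 = 0 :> 'cV_n.+1.
  apply: (unitmx_ker0 uZ).
  have -> : Z = S *m Y *m S^t* by rewrite /Y !mulmxA mulmxV // mul1mx mulmxKV.
  rewrite eX eY mulmxBl.
  rewrite -scalemxAl !mulmxA !mulmxK // -[_ *m U *m _]mulmxA UU mulmx1.
  rewrite -!mulmxA.
  have -> : diag_mx d *m delta_mx i0 0 = d 0 i0 *: delta_mx i0 0 :> 'cV[K]_n.+1.
    by apply/matrixP=> a b; rewrite mul_diag_mx !mxE; case: eqP => [->|]; rewrite ?mulr0.
  by rewrite -!scalemxAr subrr.
move=> /(congr1 (mulmx (U *m S^t*))); rewrite !mulmxA mulmxK // UU mul1mx mulmx0.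
by move/matrixP/(_ i0 0); rewrite !mxE !eqxx => /eqP; rewrite oner_eq0.
Qed.

End Adjoint.

(** * The Riccati operator *)

Section Riccati.
Context {K : numClosedFieldType} {n : nat}.
Implicit Types F G N P Q S T V W X Y Z : 'M[K]_n.

(* Controllability of the pair (F, P): [ker N] ranges over all subspaces, and
   those that are invariant under [F^t*] and contained in [ker P] are trivial.
   Applied to the adjoint of [F], this is observability of (P, F). *)
Definition controllable F P : Prop := forall N,
  (forall u : 'cV_n, N *m u = 0 -> P *m u = 0 /\ N *m F^t* *m u = 0) ->
  N \in unitmx.

(** For [u] in the kernel of [N], the form of the left side vanishes at [u], so [V u = 0]; the
    equation applied to [u] then gives [N G^t* u = 0]. Thus the kernel of [N] is of the kind that
    controllability excludes. *)
Lemma lyapunov_unit G N V : psd N -> psd V -> G *m N + N *m G^t* = - V ->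
  controllable G V -> N \in unitmx.
Proof.
move=> pN pV e; apply=> u Nu.
have uN : u^t* *m N = 0.
  by rewrite -[N]pN.1 -adjmxM Nu adjmx0.
have Vu : V *m u = 0.
  apply: psd_ker => //; rewrite -[V]opprK -e quadformN quadformD /quadform.
  by rewrite -!mulmxA Nu (mulmxA _ N) uN !mulmx0 mul0mx mxE addr0 oppr0.
split=> //; have := congr1 (mulmx^~ u) e; rewrite /= mulNmx Vu oppr0 mulmxDl.
by rewrite -mulmxA Nu mulmx0 add0r.
Qed.

Lemma controllable_sub G V V' : controllable G V ->
  (forall u : 'cV_n, V' *m u = 0 -> V *m u = 0) -> controllable G V'.
Proof. by move=> c VV' N hN; apply: c => u /hN[/VV' ? ?]. Qed.

(* If [Z] were not nonnegative, [Z - l X] would be nonnegative and singular for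
   some [l < 0], and it solves a Lyapunov equation. *)
Lemma lyapunov_psd G X V Z W : psd X -> psd V -> G *m X + X *m G^t* = - V ->
  controllable G V -> Z^t* = Z -> psd W -> G *m Z + Z *m G^t* = - W -> psd Z.
Proof.
move=> pX pV eX cV hZ pW eZ.
have uX : X \in unitmx by apply: lyapunov_unit eX cV.
have [l [rl pl nul]] := psd_pencil pX uX hZ.
have [l0|l0] := real_ge0P rl.
  by rewrite -(subrK (l *: X) Z); apply: psdD => //; apply: psdZ.
have [n0|n0] := posnP n.
  have /matrixP zl : Z = Z - l *: X.
    by apply/matrixP=> i; have := ltn_ord i; rewrite {2}n0.
  by have -> : Z = Z - l *: X by apply/matrixP.
have /negP[] := nul n0.
have pNlV : psd (- l *: V) by apply: psdZ => //; rewrite oppr_ge0 ltW.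
apply: (@lyapunov_unit G _ (W + - l *: V)) => //; first exact: psdD.
  transitivity ((G *m Z + Z *m G^t*) - l *: (G *m X + X *m G^t*)); first by mxring.
  by rewrite eX eZ; mxring.
apply: controllable_sub cV _ => u /psdD_ker[//|//|_].
by apply: psdZ_ker; rewrite oppr_eq0 lt_eqF.
Qed.

(** In finite dimension injectivity of [L] suffices. A Hermitian [Z] in its kernel is nonnegative
    together with [- Z]; any other element of the kernel splits into Hermitian ones because [L]
    commutes with the adjoint. Injectivity also makes the solution Hermitian. *)
Lemma lyapunov_solve G X V W : psd X -> psd V -> G *m X + X *m G^t* = - V ->
  controllable G V -> W^t* = W ->
  exists Z, Z^t* = Z /\ G *m Z + Z *m G^t* = W.
Proof.
move=> pX pV eX cV hW.
pose L : {linear 'M[K]_n -> 'M[K]_n} := mulmx G \+ mulmxr (G^t*).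
have LE Z : L Z = G *m Z + Z *m G^t* by [].
have Ladj Z : L (Z^t*) = (L Z)^t* by rewrite !LE !adjE addrC.
have L_herm0 Z : Z^t* = Z -> L Z = 0 -> Z = 0.
  have := @lyapunov_psd G X V _ 0 pX pV eX cV _ (psd0 _); rewrite oppr0 => lp.
  move=> hZ LZ; apply: psd_antisym; apply: lp => //; first by rewrite adjmxN hZ.
  by rewrite mulmxN mulNmx -opprD -LE LZ oppr0.
have L_inj Z : L Z = 0 -> Z = 0.
  move=> LZ.
  have LZ' : L (Z^t*) = 0 by rewrite Ladj LZ adjmx0.
  have e1 : Z + Z^t* = 0.
    apply: L_herm0; first by rewrite !adjE addrC.
    by rewrite linearD LZ LZ' addr0.
  have e2 : 'i *: (Z - Z^t*) = 0.
    apply: L_herm0; first by rewrite adjmxZ conjCi !adjE scaleNr -scalerN opprB.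
    by rewrite linearZ_LR linearB LZ LZ' subrr scaler0.
  have {}e2 : Z - Z^t* = 0.
    by move/eqP: e2; rewrite scaler_eq0 (negPf (neq0Ci K)) => /eqP.
  have : Z *+ 2 = 0 by rewrite mulr2n -{1}(addrNK (Z^t*) Z) e2 add0r addrC.
  by move/eqP; rewrite -scaler_nat scaler_eq0 pnatr_eq0 => /eqP.
have uL : lin_mx L \in unitmx.
  rewrite -row_free_unit; apply: inj_row_free => v; rewrite mul_rV_lin.
  move=> /(congr1 vec_mx); rewrite mxvecK linear0 => /L_inj /(congr1 mxvec).
  by rewrite vec_mxK linear0.
pose Z := vec_mx (mxvec W *m invmx (lin_mx L)).
have LZ : L Z = W by rewrite -mx_rV_lin mulmxKV // mxvecK.
exists Z; split=> //; apply/eqP; rewrite -subr_eq0; apply/eqP; apply: L_inj.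
by rewrite linearB Ladj LZ hW subrr.
Qed.

Variables F P Q : 'M[K]_n.
Hypotheses (pP : psd P) (pQ : psd Q).

Definition ric X := F *m X + X *m F^t* - X *m Q *m X + P.

Lemma ric_adj X : X^t* = X -> (ric X)^t* = ric X.
Proof. by move=> hX; rewrite /ric !adjE hX pP.1 pQ.1 mulmxA (addrC (X *m _)). Qed.

Lemma psd_conj_herm X Z : X^t* = X -> psd Z -> psd (X *m Z *m X).
Proof. by move=> hX /(psd_congr X); rewrite hX. Qed.

Hypothesis cFP : controllable F P.

(** * The closed loop of a nonnegative supersolution *)

Section ClosedLoop.
Variable S : 'M[K]_n.
Hypotheses (pS : psd S) (ricS : psd (- ric S)).
Let G := F - S *m Q.
(** Chosen so that [S] solves the Lyapunov equation of [G] with right side [- V]; each of the three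
    summands is nonnegative. *)
Let V := - ric S + S *m Q *m S + P.

Let pV : psd V.
Proof. by do 2?apply: psdD => //; apply: psd_conj_herm => //; exact: pS.1. Qed.

Let eS : G *m S + S *m G^t* = - V.
Proof. by rewrite /G /V /ric !adjE pQ.1 pS.1; mxring. Qed.

(** [V u = 0] annihilates each summand, so [Q S u = 0] and [G^t* u = F^t* u]: feedback does not
    change the subspaces in question. *)
Let cV : controllable G V.
Proof.
move=> N hN; apply: cFP => u /hN[Vu NGu].
have pSQS := psd_conj_herm pS.1 pQ.
have [h1 Pu] := psdD_ker (psdD ricS pSQS) pP Vu.
have [_ SQSu] := psdD_ker ricS pSQS h1.
have QSu : Q *m S *m u = 0.
  rewrite -mulmxA; apply: psd_ker => //.
  by rewrite -quadformM pS.1; apply: quadform_ker.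
split=> //; move: NGu; rewrite /G !adjE pS.1 pQ.1 mulmxBr mulmxBl.
by rewrite -(mulmxA N (Q *m S)) QSu mulmx0 subr0.
Qed.

Lemma supersolution_unit : S \in unitmx.
Proof. exact: lyapunov_unit eS cV. Qed.

Lemma closed_loop_psd Z W : Z^t* = Z -> psd W -> G *m Z + Z *m G^t* = - W -> psd Z.
Proof. exact: lyapunov_psd eS cV. Qed.

Lemma closed_loop_solve W : W^t* = W -> exists Z, Z^t* = Z /\ G *m Z + Z *m G^t* = W.
Proof. exact: lyapunov_solve eS cV. Qed.

(** Completing the square: the Lyapunov operator of [G] sends [S - T] to
    [ric S - ric T - (S - T) Q (S - T)]. Only [T] Hermitian is asked, since the strict subsolution
    used for stability may fail to be nonnegative. *)
Lemma ric_le T : T^t* = T -> psd (ric T) -> psd (S - T).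
Proof.
move=> hT pT; have hST : (S - T)^t* = S - T by rewrite !adjE pS.1 hT.
apply: (@closed_loop_psd _ (- ric S + ric T + (S - T) *m Q *m (S - T))) => //.
  by do 2?apply: psdD => //; apply: psd_conj_herm.
by rewrite /G /ric !adjE pQ.1 pS.1; mxring.
Qed.

(* One step of the Newton-Kleinman iteration. *)
Lemma newton_step : exists X, [/\ psd X, psd (S - X) &
  ric X = - ((X - S) *m Q *m (X - S))].
Proof.
have pSQSP : psd (S *m Q *m S + P).
  by apply: psdD => //; apply: psd_conj_herm => //; exact: pS.1.
(* The linearization of [ric] at [S] vanishes at this [X], so [ric X] is the quadratic remainder
   alone. *)
have [|X [hX eX]] := @closed_loop_solve (- (S *m Q *m S + P)).
  by rewrite adjmxN pSQSP.1.
have eX' := eX; rewrite /G !adjE pS.1 pQ.1 in eX'.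
exists X; split; first exact: closed_loop_psd eX.
  apply: (@closed_loop_psd _ (- ric S)) => //; first by rewrite !adjE hX pS.1.
  transitivity (G *m S + S *m G^t* - (G *m X + X *m G^t*)); first by mxring.
  by rewrite eX eS /V; mxring.
have e0 : (F - S *m Q) *m X + X *m (F^t* - Q *m S) + (S *m Q *m S + P) = 0.
  by rewrite eX' addNr.
by rewrite -[LHS]subr0 -[X in _ - X]e0 /ric; mxring.
Qed.

End ClosedLoop.

End Riccati.

(** * Existence of a supersolution *)

Section Supersolution.
Context {K : numClosedFieldType} {n : nat}.
Implicit Types F G N P Q S T V W X Y Z : 'M[K]_n.

Lemma quadform_conj N u : N^t* = N -> (quadform N u)^* = quadform N u.
Proof.
move=> hN; transitivity (((u^t* *m N *m u)^t*) 0 0); first by rewrite 2!mxE.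
by rewrite !adjE hN mulmxA.
Qed.

(** A crude bound for the operator norm, with values in [K] so that it can serve as a scalar
    matrix. *)
Definition sumnorm m p (M : 'M[K]_(m, p)) : K := \sum_i \sum_j `|M i j|.

Lemma sumnorm_ge0 m p (M : 'M[K]_(m, p)) : 0 <= sumnorm M.
Proof. by apply: sumr_ge0 => i _; apply: sumr_ge0. Qed.

Lemma psd_sumnorm N : N^t* = N -> psd ((sumnorm N)%:M + N).
Proof.
move=> hN; have c0 := sumnorm_ge0 N.
have hc : psd ((sumnorm N)%:M : 'M[K]_n) by rewrite -scalemx1; apply: psdZ (psd1 _).
split=> [|u]; first by rewrite adjmxD hc.1 hN.
have Nr : quadform N u \is Num.real by apply/CrealP/quadform_conj.
rewrite quadformD -scalemx1 quadformZ -[X in _ + X]opprK subr_ge0.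
apply: le_trans (real_ler_norm _) _; first by rewrite rpredN.
rewrite normrN quadform1 /quadform mxE /sumnorm exchange_big /= mulr_suml.
apply: le_trans (ler_norm_sum _ _ _) _; apply: ler_sum => j _.
rewrite mxE mulr_suml; apply: le_trans (ler_norm_sum _ _ _) _.
rewrite mulr_suml; apply: ler_sum => i _.
rewrite !mxE !normrM norm_conjC mulrAC (mulrC _ `|N i j|).
apply: ler_wpM2l => //.
have le_sq k : `|u k 0| ^+ 2 <= \sum_k `|u k 0| ^+ 2.
  by rewrite (bigD1 k) //= lerDl sumr_ge0 // => ? _; apply: exprn_ge0.
(* The product of two moduli is at most the larger square. *)
have [ij|/ltW ji] := real_leP (normr_real (u i 0)) (normr_real (u j 0)).
  by apply: le_trans (le_sq j); rewrite expr2 ler_wpM2r.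
by apply: le_trans (le_sq i); rewrite expr2 ler_wpM2l.
Qed.

(* Bass's construction: [S] is a large multiple of [Y^-1], where [Y] solves
   [(F + b)^t* Y + Y (F + b) = 2 Q] with [b] so large that [-(F + b)] is
   dissipative. *)
Lemma supersolution_exists F P Q : psd P -> psd Q -> controllable (F^t*) Q ->
  exists S, psd S /\ psd (- ric F P Q S).
Proof.
move=> pP pQ oFQ.
have hFF : (F + F^t*)^t* = F + F^t* by rewrite !adjE addrC.
set c := sumnorm (F + F^t*); have c0 : 0 <= c := sumnorm_ge0 _.
pose b := c + 1; have b0 : 0 < b by rewrite ltr_wpDl.
have bJ : b^* = b by apply/CrealP/ger0_real/ltW.
pose G := - F^t* - b *: 1%:M.
have GE : G^t* = - F - b *: 1%:M by rewrite /G !adjE adjmxZ bJ adjmx1.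
(* Since [2 b = c + (c + 2)], this is [- G - G^t*], written as a nonnegative matrix plus a positive
   scalar; the identity thus certifies that [G] is stable. *)
pose V := (c%:M + (F + F^t*)) + (c + 2) *: 1%:M.
have c2 : 0 < c + 2 by rewrite ltr_wpDl // ltr0n.
have pc2 : psd ((c + 2) *: 1%:M : 'M[K]_n) by apply: psdZ (ltW _) (psd1 _).
have pV : psd V by apply: psdD pc2; apply: psd_sumnorm.
have eV : G *m 1%:M + 1%:M *m G^t* = - V.
  by rewrite mulmx1 mul1mx GE /G /V /b -scalemx1; apply/matrixP=> i j; rewrite !mxE; ring.
have cV : controllable G V.
  move=> N hN; apply: ker0_unitmx => u /hN[Vu _].
  have [_] := psdD_ker (psd_sumnorm hFF) pc2 Vu.
  by move=> /psdZ_ker; rewrite mul1mx; apply; rewrite gt_eqF.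
have pQ2 : psd (2 *: Q) by apply: psdZ pQ; rewrite ler0n.
have hQ2 : (- (2 *: Q))^t* = - (2 *: Q) by rewrite adjmxN pQ2.1.
have [Y [hY eY]] := lyapunov_solve (psd1 n) pV eV cV hQ2.
have pY : psd Y := lyapunov_psd (psd1 n) pV eV cV hY pQ2 eY.
(* On the kernel of [N] the shift by [b] disappears, so invariance under [G^t*] is invariance under
   [F], and observability applies. *)
have uY : Y \in unitmx.
  apply: lyapunov_unit pY pQ2 eY _ => N hN; apply: oFQ => u Nu.
  have [/psdZ_ker Qu] := hN u Nu; rewrite trmxCK.
  rewrite GE mulmxBr -scalemxAr mulmx1 mulmxBl -scalemxAl Nu scaler0 subr0.
  rewrite mulmxN mulNmx => /eqP; rewrite oppr_eq0 => /eqP; split=> //.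
  by apply: Qu; rewrite pnatr_eq0.
set Yi := invmx Y.
have hYi : Yi^t* = Yi.
  by rewrite /Yi trmx_inv map_invmx hY.
have YYi : Y *m Yi = 1%:M := mulmxV uY.
have YiY : Yi *m Y = 1%:M := mulVmx uY.
have pYi : psd Yi.
  by rewrite -[Yi]mul1mx -YiY -{1}hYi; apply: psd_congr.
have uYi : Yi \in unitmx by rewrite unitmx_inv.
have [l [rl pl _]] : exists l : K, [/\ l \is Num.real, psd (- P - l *: Yi) &
    ((0 < n)%N -> - P - l *: Yi \notin unitmx)].
  by apply: psd_pencil; rewrite // adjmxN pP.1.
(* By the choice of [l], [- l Y^-1] dominates [P]. Now [- ric (s Y^-1)] is the sum of
   [s (s - 2) Y^-1 Q Y^-1], [(2 s b + l) Y^-1] and [- P - l Y^-1]; this [s] makes both coefficients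
   nonnegative. *)
pose s := 2 + `|l| / (2 * b).
have s2 : 2 <= s by rewrite lerDl divr_ge0 // mulr_ge0 ?ler0n // ltW.
have s0 : 0 <= s by apply: le_trans s2; rewrite ler0n.
have sb : 0 <= 2 * s * b + l.
  rewrite /s; have -> : 2 * (2 + `|l| / (2 * b)) * b = 4 * b + `|l|.
    by field; rewrite gt_eqF.
  rewrite -addrA addr_ge0 ?mulr_ge0 ?ler0n ?(ltW b0) //.
  by rewrite -[l in _ + l]opprK subr_ge0 -normrN real_ler_norm // rpredN.
exists (s *: Yi); split; first exact: psdZ.
have eF : F *m Yi + Yi *m F^t* = 2 *: (Yi *m Q *m Yi) - (2 * b) *: Yi.
  have : Yi *m (G *m Y + Y *m G^t*) *m Yi = Yi *m (- (2 *: Q)) *m Yi by rewrite eY.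
  rewrite GE /G mulmxDr mulmxDl !mulmxA YiY mul1mx -[_ *m Y *m Yi]mulmxA YYi mulmx1.
  rewrite mulmxBr mulmxBl -!scalemxAr -!scalemxAl mulmx1 mul1mx !mulmxN !mulNmx.
  rewrite -scalemxAr -scalemxAl => e.
  move: (Yi *m F^t*) (F *m Yi) (Yi *m Q *m Yi) e => M1 M2 M3 e.
  apply/matrixP => i j; move/matrixP/(_ i j): e; rewrite !mxE => e.
  apply/eqP; rewrite -subr_eq0; apply/eqP.
  by move/eqP: e; rewrite -subr_eq0 -oppr_eq0 => /eqP <-; ring.
rewrite [X in psd X](_ : _ = (s * (s - 2)) *: (Yi *m Q *m Yi) +
  ((2 * s * b + l) *: Yi + (- P - l *: Yi))).
  apply: psdD; last by apply: psdD pl; apply: psdZ.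
  apply: psdZ; first by rewrite mulr_ge0 // subr_ge0.
  exact: psd_conj_herm.
rewrite /ric -!scalemxAr -!scalemxAl -scalerDr eF scalerA.
by mxring.
Qed.

End Supersolution.

(** * Minimal realizations *)

Section Minimality.
Variable R : realType.

Lemma constmxM m n p (M : 'M[R[i]]_(m, n)) (N : 'M_(n, p)) :
  constmx (M *m N) = constmx M *m constmx N.
Proof. exact: (map_mxM (@tofrac {poly R[i]} \o polyC)). Qed.

Lemma char_poly_mx_unit n (A : 'M[R[i]]_n) :
  map_mx (@tofrac _) (char_poly_mx A) \in unitmx.
Proof.
rewrite unitmxE unitfE det_map_mx tofrac_eq0.
exact: monic_neq0 (char_poly_monic A).
Qed.

(** [p] intertwines [zI - A] with [zI - A'], hence also their inverses. It may be rectangular, so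
    the two state spaces can differ in size. *)
Lemma transfer_intertwined m1 m2 n k 
    (A : 'M_n) (B : 'M_(n, m2)) (C : 'M_(m1, n))
    (A' : 'M_k) (B' : 'M_(k, m2)) (C' : 'M_(m1, k)) (p : 'M[R[i]]_(k, n)) :
  p *m A = A' *m p -> B' = p *m B -> C = C' *m p ->
  transfer A B C = transfer A' B' C'.
Proof.
move=> pA -> ->; rewrite /transfer !constmxM !mulmxA; congr (_ *m _).
rewrite -!mulmxA; congr (_ *m _).
have e : constmx p *m map_mx (@tofrac _) (char_poly_mx A) =
         map_mx (@tofrac _) (char_poly_mx A') *m constmx p.
  have -> : constmx p = map_mx (@tofrac _) (map_mx polyC p).
    by apply/matrixP=> i j; rewrite !mxE.
  rewrite -!map_mxM; congr map_mx.
  by rewrite /char_poly_mx mulmxBr mulmxBl -!map_mxM pA scalar_mxC.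
rewrite -[RHS]mulmx1 -(mulmxV (char_poly_mx_unit A)) !mulmxA.
by rewrite -[_ *m _ *m map_mx _ _]mulmxA e mulmxA mulVmx ?mul1mx // char_poly_mx_unit.
Qed.

Variables (m1 m2 n : nat) (phi : ratmx R m1 m2).
Variables (A : 'M[R[i]]_n) (B : 'M[R[i]]_(n, m2)) (C : 'M[R[i]]_(m1, n)).
Hypothesis min : minimal_realization phi A B C.

Lemma rank_unitmx (Z : 'M[R[i]]_n) : (n <= \rank Z)%N -> Z \in unitmx.
Proof.
by move=> h; rewrite -row_free_unit /row_free eqn_leq h rank_leq_row.
Qed.

(** The row space of [Z] is invariant under [A] and contains the rows of [C]. Compressing to
    [row_base Z] therefore gives a realization of size [\rank Z]. *)
Lemma minimal_observable (Z D : 'M[R[i]]_n) (E : 'M_(m1, n)) :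
  Z *m A = D *m Z -> C = E *m Z -> Z \in unitmx.
Proof.
move=> ZA CZ; apply: rank_unitmx; case: min => rea minn.
have [/= L LK] := row_fullP (col_base_full Z).
have rE : row_base Z = L *m Z.
  by rewrite -[LHS]mul1mx -LK -mulmxA mulmx_base.
apply: (minn _ (L *m D *m col_base Z) (row_base Z *m B) (E *m col_base Z)).
rewrite /realization rea; apply: transfer_intertwined (row_base Z) _ _ _ => //.
  by rewrite -[RHS]mulmxA mulmx_base rE -!mulmxA ZA.
by rewrite CZ -mulmxA mulmx_base.
Qed.

(** Dually, the system is compressed to the column space of [Z]. *)
Lemma minimal_controllable (Z D : 'M[R[i]]_n) (E : 'M_(n, m2)) :
  A *m Z = Z *m D -> B = Z *m E -> Z \in unitmx.
Proof.
move=> AZ BZ; apply: rank_unitmx; case: min => rea minn.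
have [/= L LK] := row_freeP (row_base_free Z).
have cE : col_base Z = Z *m L.
  by rewrite -[LHS]mulmx1 -LK mulmxA mulmx_base.
apply: (minn _ (row_base Z *m D *m L) (row_base Z *m E) (C *m col_base Z)).
rewrite /realization rea; apply/esym.
apply: transfer_intertwined (col_base Z) _ _ _ => //.
  by rewrite 2!mulmxA mulmx_base cE !mulmxA AZ.
by rewrite BZ mulmxA mulmx_base.
Qed.

(** The kernel of [B B^t*] is that of [B^t*]; the kernel conditions become factorizations through
    [N], whose adjoints say that the column space of [N^t*] is invariant under [A] and contains that
    of [B]. *)
Lemma minimal_riccati_controllable : controllable ('i *: A) (B *m B^t*).
Proof.
move=> N hN.
have [E eE] : exists E, B^t* = E *m N.
  apply: factor_ker => u /hN[BBu _].
  by apply: gram_ker; rewrite trmxCK.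
have [D eD] : exists D, N *m A^t* = D *m N.
  apply: factor_ker => u /hN[_]; rewrite adjmxZ -scalemxAr => /psdZ_ker; apply.
  by rewrite conjC_eq0 neq0Ci.
suff : N^t* \in unitmx by rewrite map_unitmx unitmx_tr.
apply: (@minimal_controllable _ (D^t*) (E^t*)).
  by rewrite -[A]trmxCK -!adjmxM eD.
by rewrite -adjmxM -eE trmxCK.
Qed.

Lemma minimal_riccati_observable : controllable (('i *: A)^t*) (C^t* *m C).
Proof.
move=> N hN.
have [E eE] : exists E, C = E *m N.
  by apply: factor_ker => u /hN[CCu _]; apply: gram_ker.
have [D eD] : exists D, N *m A = D *m N.
  apply: factor_ker => u /hN[_]; rewrite trmxCK -scalemxAr => /psdZ_ker; apply.
  exact: neq0Ci.
exact: minimal_observable eD eE.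
Qed.

End Minimality.

(** * Entrywise convergence *)

Section ComplexConvergence.
Local Open Scope classical_set_scope.
Context {R : realType} {T : Type} {F : set_system T} {FF : Filter F}.
Local Notation Re := (@complex.Re R).
Local Notation Im := (@complex.Im R).
Implicit Types f g : T -> R[i].

Lemma ReD (x y : R[i]) : Re (x + y) = Re x + Re y. Proof. by case: x; case: y. Qed.
Lemma ImD (x y : R[i]) : Im (x + y) = Im x + Im y. Proof. by case: x; case: y. Qed.
Lemma ReN (x : R[i]) : Re (- x) = - Re x. Proof. by case: x. Qed.
Lemma ImN (x : R[i]) : Im (- x) = - Im x. Proof. by case: x. Qed.
Lemma ReM (x y : R[i]) : Re (x * y) = Re x * Re y - Im x * Im y.
Proof. by case: x; case: y. Qed.
Lemma ImM (x y : R[i]) : Im (x * y) = Re x * Im y + Im x * Re y.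
Proof. by case: x => a b; case: y => c d; rewrite /= mulrC. Qed.
Lemma ReJ (x : R[i]) : Re x^* = Re x. Proof. by case: x. Qed.
Lemma ImJ (x : R[i]) : Im x^* = - Im x. Proof. by case: x. Qed.

Lemma ReZ (a : R) (x : R[i]) : Re (a%:C%C * x) = a * Re x.
Proof. by case: x => b c; rewrite /= mul0r subr0. Qed.
Lemma ge0_Re (x : R[i]) : 0 <= x -> 0 <= Re x.
Proof. by rewrite lecE => /andP[]. Qed.

Definition ccvg f (l : R[i]) :=
  (Re (f x) @[x --> F] --> Re l) /\ (Im (f x) @[x --> F] --> Im l).

Lemma ccvg_cst l : ccvg (fun=> l) l.
Proof. by split; exact: cvg_cst. Qed.

Lemma ccvgD f g a b : ccvg f a -> ccvg g b -> ccvg (fun x => f x + g x) (a + b).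
Proof.
move=> [f1 f2] [g1 g2]; split; rewrite ?ReD ?ImD.
  by under eq_fun do rewrite ReD; exact: cvgD.
by under eq_fun do rewrite ImD; exact: cvgD.
Qed.

Lemma ccvgN f a : ccvg f a -> ccvg (fun x => - f x) (- a).
Proof.
move=> [f1 f2]; split; rewrite ?ReN ?ImN.
  by under eq_fun do rewrite ReN; exact: cvgN.
by under eq_fun do rewrite ImN; exact: cvgN.
Qed.

Lemma ccvgM f g a b : ccvg f a -> ccvg g b -> ccvg (fun x => f x * g x) (a * b).
Proof.
move=> [f1 f2] [g1 g2]; split; rewrite ?ReM ?ImM.
  by under eq_fun do rewrite ReM; apply: cvgB; exact: cvgM.
by under eq_fun do rewrite ImM; apply: cvgD; exact: cvgM.
Qed.

Lemma ccvgJ f a : ccvg f a -> ccvg (fun x => (f x)^*) (a^*).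
Proof.
move=> [f1 f2]; split; rewrite ?ReJ ?ImJ.
  by under eq_fun do rewrite ReJ.
by under eq_fun do rewrite ImJ; exact: cvgN.
Qed.

Lemma ccvgV f a : a != 0 -> ccvg f a -> ccvg (fun x => (f x)^-1) (a^-1).
Proof.
move=> a0 [f1 f2].
have d0 : Re a * Re a + Im a * Im a != 0.
  move: a0; apply: contra; case: a {f1 f2} => a b /=.
  by rewrite -!expr2 paddr_eq0 ?sqr_ge0 // !sqrf_eq0 eq_complex.
have ReV (x : R[i]) : Re x^-1 = Re x * (Re x * Re x + Im x * Im x)^-1.
  by case: x.
have ImV (x : R[i]) : Im x^-1 = - (Im x * (Re x * Re x + Im x * Im x)^-1).
  by case: x.
have d : (Re (f x) * Re (f x) + Im (f x) * Im (f x))^-1 @[x --> F] -->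
    (Re a * Re a + Im a * Im a)^-1.
  by apply: cvgV => //; apply: cvgD; apply: cvgM.
split; rewrite ?ReV ?ImV.
  by under eq_fun do rewrite ReV; exact: cvgM.
by under eq_fun do rewrite ImV; apply: cvgN; exact: cvgM.
Qed.

Lemma ccvg_sum (I : Type) (r : seq I) (f : I -> T -> R[i]) (a : I -> R[i]) :
  (forall i, ccvg (f i) (a i)) -> ccvg (fun x => \sum_(i <- r) f i x) (\sum_(i <- r) a i).
Proof.
move=> fa; elim: r => [|i r IH].
  by rewrite big_nil; under eq_fun do rewrite big_nil; exact: ccvg_cst.
by rewrite big_cons; under eq_fun do rewrite big_cons; exact: ccvgD.
Qed.

Lemma ccvg_prod (I : Type) (r : seq I) (f : I -> T -> R[i]) (a : I -> R[i]) :
  (forall i, ccvg (f i) (a i)) -> ccvg (fun x => \prod_(i <- r) f i x) (\prod_(i <- r) a i).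
Proof.
move=> fa; elim: r => [|i r IH].
  by rewrite big_nil; under eq_fun do rewrite big_nil; exact: ccvg_cst.
by rewrite big_cons; under eq_fun do rewrite big_cons; exact: ccvgM.
Qed.

Lemma ccvg_norm0 f : ccvg f 0 -> ccvg (fun x => `|f x|) 0.
Proof.
move=> [f1 f2]; split; last first.
  by under eq_fun do rewrite normc_def; exact: cvg_cst.
have -> : Re 0 = Num.sqrt (0 * 0 + 0 * 0 : R) by rewrite mul0r addr0 sqrtr0.
under eq_fun do rewrite normc_def.
apply: continuous_cvg; first exact: sqrt_continuous.
by under eq_fun do rewrite !expr2; apply: cvgD; apply: cvgM.
Qed.

Lemma ccvg_near_lt f (e : R) : ccvg f 0 -> (forall x, 0 <= f x) -> 0 < e ->
  \forall x \near F, f x < e%:C%C.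
Proof.
move=> [f1 _] f0 e0; move/cvgrPdist_lt/(_ _ e0): f1; apply: filterS => x.
rewrite sub0r normrN => h; rewrite ltcE (ger0_Im (f0 x)) eqxx /=.
exact: le_lt_trans (ler_norm _) h.
Qed.

Lemma ccvg_unique {PF : ProperFilter F} f a b : ccvg f a -> ccvg f b -> a = b.
Proof.
move=> [f1 f2] [g1 g2]; apply/eqP; rewrite eq_complex.
by rewrite (norm_cvg_unique f1 g1) (norm_cvg_unique f2 g2) !eqxx.
Qed.

Lemma ccvg_ge0 {PF : ProperFilter F} f a : ccvg f a -> (forall x, 0 <= f x) -> 0 <= a.
Proof.
move=> [f1 f2] f0; rewrite lecE /=; apply/andP; split.
  have g2 : Im (f x) @[x --> F] --> (0 : R).
    by under eq_fun do rewrite (ger0_Im (f0 _)); exact: cvg_cst.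
  by rewrite (norm_cvg_unique f2 g2).
have <- := norm_cvg_lim f1.
apply: limr_ge; first by apply/cvg_ex; exists (Re a).
by apply: nearW => x; have := f0 x; rewrite lecE => /andP[].
Qed.

Definition mxcvg m n (G : T -> 'M[R[i]]_(m, n)) (L : 'M[R[i]]_(m, n)) :=
  forall i j, ccvg (fun x => G x i j) (L i j).

Lemma mxcvg_cst m n (L : 'M_(m, n)) : mxcvg (fun=> L) L.
Proof. by move=> i j; exact: ccvg_cst. Qed.

Lemma mxcvgD m n (G H : T -> 'M_(m, n)) L M :
  mxcvg G L -> mxcvg H M -> mxcvg (fun x => G x + H x) (L + M).
Proof.
move=> GL HM i j; rewrite mxE; under eq_fun do rewrite mxE; exact: ccvgD.
Qed.

Lemma mxcvgN m n (G : T -> 'M_(m, n)) L : mxcvg G L -> mxcvg (fun x => - G x) (- L).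
Proof. by move=> GL i j; rewrite mxE; under eq_fun do rewrite mxE; exact: ccvgN. Qed.

Lemma mxcvgB m n (G H : T -> 'M_(m, n)) L M :
  mxcvg G L -> mxcvg H M -> mxcvg (fun x => G x - H x) (L - M).
Proof. by move=> GL HM; apply: mxcvgD => //; exact: mxcvgN. Qed.

Lemma mxcvgM m n p (G : T -> 'M_(m, n)) (H : T -> 'M_(n, p)) L M :
  mxcvg G L -> mxcvg H M -> mxcvg (fun x => G x *m H x) (L *m M).
Proof.
move=> GL HM i j; rewrite mxE; under eq_fun do rewrite mxE.
by apply: ccvg_sum => k; exact: ccvgM.
Qed.

Lemma mxcvgZ m n f a (G : T -> 'M_(m, n)) L :
  ccvg f a -> mxcvg G L -> mxcvg (fun x => f x *: G x) (a *: L).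
Proof. by move=> fa GL i j; rewrite mxE; under eq_fun do rewrite mxE; exact: ccvgM. Qed.

Lemma mxcvg_adj m n (G : T -> 'M_(m, n)) L :
  mxcvg G L -> mxcvg (fun x => (G x)^t*) (L^t*).
Proof.
move=> GL i j; rewrite !mxE; under eq_fun do rewrite !mxE; exact: ccvgJ.
Qed.

Lemma ccvg_det n (G : T -> 'M_n) L : mxcvg G L -> ccvg (fun x => \det (G x)) (\det L).
Proof.
move=> GL; apply: ccvg_sum => s; apply: ccvgM; first exact: ccvg_cst.
exact: ccvg_prod.
Qed.

(** Cramer's rule: the entries are cofactors divided by the determinant. *)
Lemma mxcvg_inv n (G : T -> 'M_n) L : L \in unitmx -> (forall x, G x \in unitmx) ->
  mxcvg G L -> mxcvg (fun x => invmx (G x)) (invmx L).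
Proof.
move=> uL uG GL; rewrite /invmx uL; under eq_fun do rewrite uG.
apply: mxcvgZ; first by apply: ccvgV (ccvg_det GL); rewrite -unitfE.
move=> i j; rewrite mxE; under eq_fun do rewrite mxE.
apply: ccvgM; first exact: ccvg_cst.
by apply: ccvg_det => a b; rewrite !mxE; under eq_fun do rewrite !mxE.
Qed.

Lemma ccvg_quadform n (G : T -> 'M_n) L u : mxcvg G L ->
  ccvg (fun x => quadform (G x) u) (quadform L u).
Proof. by move=> GL; apply: mxcvgM; [apply: mxcvgM => // |]; exact: mxcvg_cst. Qed.

Lemma ccvg_sumnorm m n (G : T -> 'M_(m, n)) : mxcvg G 0 ->
  ccvg (fun x => sumnorm (G x)) 0.
Proof.
move=> GL; have -> : 0 = \sum_(i : 'I_m) \sum_(j : 'I_n) (0 : R[i]).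
  by rewrite big1 // => i _; rewrite big1.
apply: ccvg_sum => i; apply: ccvg_sum => j; apply: ccvg_norm0.
by have := GL i j; rewrite mxE.
Qed.

Lemma mxcvg_polarization n (G : T -> 'M_n) (l : 'cV[R[i]]_n -> R[i]) :
  (forall u, ccvg (fun x => quadform (G x) u) (l u)) ->
  mxcvg G (\matrix_(i, j) polarization l i j).
Proof.
move=> h i j; rewrite mxE; under eq_fun do rewrite -polarizationE.
apply: ccvgM; last exact: ccvg_cst.
apply: ccvgD; last by apply: ccvgN; apply: ccvgM; [exact: ccvg_cst|exact: ccvgD].
by apply: ccvgD => //; apply: ccvgN; apply: ccvgM => //; exact: ccvg_cst.
Qed.

Lemma mxcvg_quadform n (G : T -> 'M_n) (L : 'M[R[i]]_n) :
  (forall u, ccvg (fun x => quadform (G x) u) (quadform L u)) -> mxcvg G L.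
Proof.
move=> /mxcvg_polarization h i j; have := h i j.
by rewrite mxE polarizationE.
Qed.

End ComplexConvergence.
Arguments ccvg {R T} F.
Arguments mxcvg {R T} F [m n].

(** * Existence and stability of the solution *)

Lemma mxcvg_unique {R : realType} {T : Type} {F : set_system T} {PF : ProperFilter F}
    m n (G : T -> 'M[R[i]]_(m, n)) L M :
  mxcvg F G L -> mxcvg F G M -> L = M.
Proof.
by move=> GL GM; apply/matrixP => i j; apply: ccvg_unique (GL i j) (GM i j).
Qed.

Lemma mxcvg_ric {R : realType} {T : Type} {Fl : set_system T} {FF : Filter Fl} n
    (F P Q X : T -> 'M[R[i]]_n) F0 P0 Q0 X0 :
  mxcvg Fl F F0 -> mxcvg Fl P P0 -> mxcvg Fl Q Q0 -> mxcvg Fl X X0 ->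
  mxcvg Fl (fun x => ric (F x) (P x) (Q x) (X x)) (ric F0 P0 Q0 X0).
Proof.
move=> hF hP hQ hX; apply: mxcvgD => //; apply: mxcvgB; last first.
  by apply: mxcvgM => //; apply: mxcvgM.
by apply: mxcvgD; apply: mxcvgM => //; apply: mxcvg_adj.
Qed.

Section Existence.
Context {R : realType} {n : nat}.
Variables F P Q : 'M[R[i]]_n.
Hypotheses (pP : psd P) (pQ : psd Q).
Hypotheses (cFP : controllable F P) (oFQ : controllable (F^t*) Q).

(** Each quadratic form decreases along the sequence and is bounded below by [0]; polarization turns
    the limits of the forms into limits of the entries. *)
Lemma antitone_psd_cvg (X : nat -> 'M[R[i]]_n) :
  (forall k, psd (X k)) -> (forall k, psd (X k - X k.+1)) ->
  exists L, mxcvg \oo%classic X L.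
Proof.
move=> pX dX.
have [u|l hl] := @choice _ _ (fun u l => ccvg \oo%classic (fun k => quadform (X k) u) l).
  pose q k := complex.Re (quadform (X k) u).
  have q0 k : 0 <= q k by exact/ge0_Re/(pX k).2.
  have qS k : q k.+1 <= q k.
    by have := ge0_Re ((dX k).2 u); rewrite quadformD quadformN ReD ReN subr_ge0.
  have qcvg : cvgn q.
    apply: nonincreasing_is_cvgn; last by exists 0 => _ [k _ <-].
    exact/nonincreasing_seqP.
  exists ((limn q)%:C%C); split; first exact: qcvg.
  have -> : (fun k => complex.Im (quadform (X k) u)) = fun=> 0.
    by apply/funext => k; apply/ger0_Im/(pX k).2.
  exact: cvg_cst.
by exists (\matrix_(i, j) polarization l i j); apply: mxcvg_polarization.
Qed.

Lemma riccati_solution_exists : exists X, psd X /\ ric F P Q X = 0.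
Proof.
pose super S := psd S /\ psd (- ric F P Q S).
have [S0 pS0] : exists S, super S := supersolution_exists pP pQ oFQ.
(* [f] must be total, so the requirement is conditional on [super S], with the value [0]
   elsewhere. *)
have [S|f fP] := @choice _ _ (fun S S' => super S -> [/\ super S', psd (S - S') &
    ric F P Q S' = - ((S' - S) *m Q *m (S' - S))]).
  have [[pS rS]|nS] := pselect (super S); last by exists 0.
  have [X [pX SX eX]] := newton_step pP pQ cFP pS rS.
  exists X => _; split; [split; [exact: pX|rewrite eX opprK] | exact: SX | exact: eX].
  by apply: psd_conj_herm => //; rewrite adjmxB pX.1 pS.1.
pose X k := iter k f S0.
have sX k : super (X k).
  by elim: k => [|k IH]; [exact: pS0 | have [h _ _] := fP _ IH; exact: h].
have pX k : psd (X k) := (sX k).1.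
have [|L XL] := @antitone_psd_cvg X pX; first by move=> k; have [] := fP _ (sX k).
have XSL : mxcvg \oo%classic (fun k => X k.+1) L.
  by move=> i j; split; [have [h _] := XL i j | have [_ h] := XL i j];
    rewrite (cvg_shiftS (fun k => _ (X k i j))).
exists L; split; first split.
- apply: (mxcvg_unique _ XL).
  have : mxcvg \oo%classic (fun k => (X k)^t*) (L^t*) by exact: mxcvg_adj.
  by under eq_fun do rewrite (pX _).1.
- by move=> u; apply: (ccvg_ge0 (ccvg_quadform u XL)) => k; apply: (pX k).2.
have c (M : 'M[R[i]]_n) : mxcvg \oo%classic (fun=> M) M by exact: mxcvg_cst.
(* The residual at [X k.+1] is quadratic in the increment, which tends to [0]. *)
have h : mxcvg \oo%classic (fun k => - ((X k.+1 - X k) *m Q *m (X k.+1 - X k)))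
    (- ((L - L) *m Q *m (L - L))).
  by apply: mxcvgN; apply: mxcvgM; [apply: mxcvgM => //|]; apply: mxcvgB.
rewrite subrr mulmx0 oppr0 in h.
apply: (mxcvg_unique (mxcvg_ric (c F) (c P) (c Q) XSL)).
suff -> : (fun k => ric F P Q (X k.+1)) =
  fun k => - ((X k.+1 - X k) *m Q *m (X k.+1 - X k)) by [].
by apply/funext => k; have [_ _ ->] := fP _ (sX k).
Qed.

End Existence.

(** * Continuous dependence of the solution on the data *)

Section Stability.
Context {R : realType} {n : nat} {T : Type} {Fl : set_system T} {FF : Filter Fl}.
Variables (F P Q X : T -> 'M[R[i]]_n) (F0 P0 Q0 X0 : 'M[R[i]]_n).
Hypotheses (pP : forall x, psd (P x)) (pQ : forall x, psd (Q x)) (pX : forall x, psd (X x)).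
Hypotheses (cFP : forall x, controllable (F x) (P x)).
Hypothesis ricX : forall x, ric (F x) (P x) (Q x) (X x) = 0.
Hypotheses (pP0 : psd P0) (pQ0 : psd Q0) (pX0 : psd X0) (cFP0 : controllable F0 P0).
Hypothesis ricX0 : ric F0 P0 Q0 X0 = 0.
Hypotheses (cvgF : mxcvg Fl F F0) (cvgP : mxcvg Fl P P0) (cvgQ : mxcvg Fl Q Q0).

Lemma sumnormN m p (M : 'M[R[i]]_(m, p)) : sumnorm (- M) = sumnorm M.
Proof.
by apply: eq_bigr => i _; apply: eq_bigr => j _; rewrite mxE normrN.
Qed.

Lemma sumnorm_real m p (M : 'M[R[i]]_(m, p)) : exists2 c : R, 0 <= c & sumnorm M = c%:C%C.
Proof.
have := sumnorm_ge0 M; case: (sumnorm M) => a b; rewrite lecE /= => /andP[/eqP -> a0].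
by exists a.
Qed.

(* [X0 + t Z] is a strict supersolution and [X0 - t Z] a strict subsolution for
   the limit data, hence both remain so for nearby data. *)
Lemma riccati_sandwich : exists2 Z : 'M[R[i]]_n, psd Z & exists2 t0 : R, 0 < t0 &
  forall t : R, 0 < t -> t <= t0 -> \forall x \near Fl,
    psd (X0 + t%:C%C *: Z - X x) /\ psd (X x - (X0 - t%:C%C *: Z)).
Proof.
have pN0 : psd (- 0 : 'M[R[i]]_n) by rewrite oppr0; exact: psd0.
have rX0 : psd (- ric F0 P0 Q0 X0) by rewrite ricX0.
have [|Z [hZ eZ]] := closed_loop_solve pP0 pQ0 cFP0 pX0 rX0 (_ : (- 1%:M)^t* = _).
  by rewrite !adjE.
have pZ : psd Z := closed_loop_psd pP0 pQ0 cFP0 pX0 rX0 hZ (psd1 n) eZ.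
have pZQZ : psd (Z *m Q0 *m Z) by apply: psd_conj_herm.
have [c c0 ec] := sumnorm_real (Z *m Q0 *m Z).
(* For [t] up to this bound, [t ^+ 2 * c <= t / 2]. So the quadratic term uses at most half of the
   margin [t] of the subsolution, and [t / 2] remains for the perturbation of the data. *)
exists Z => //; exists (2 * (c + 1))^-1; first by rewrite invr_gt0 mulr_gt0 // ltr_wpDl.
move=> t t_gt0 tc; set tC := t%:C%C.
have tc2 : t ^+ 2 * c <= t / 2.
  have : t * (2 * (c + 1)) <= 1 by rewrite -ler_pdivlMr ?div1r // mulr_gt0 // ltr_wpDl.
  by move=> ht; have := ler_wpM2l (ltW t_gt0) ht; nra.
have tC0 : 0 < tC by rewrite ltcR.
have tCr : tC^* = tC by apply/CrealP/ger0_real/ltW.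
(* The expansion at [X0] is exact to second order, and the choice of [Z] makes its linear part
   [- s]. *)
have ricD (s : R[i]) : s^* = s ->
    ric F0 P0 Q0 (X0 + s *: Z) = - s *: 1%:M - s ^+ 2 *: (Z *m Q0 *m Z).
  move=> sr; have -> : - s *: 1%:M = ric F0 P0 Q0 X0 +
      s *: ((F0 - X0 *m Q0) *m Z + Z *m (F0 - X0 *m Q0)^t*) :> 'M[R[i]]_n.
    by rewrite eZ ricX0 scaleNr scalerN add0r.
  by rewrite /ric !adjE pQ0.1 pX0.1; mxring.
(* The effect of changing the data at a fixed [S]; it tends to [0] and is absorbed once its
   [sumnorm] is below [t / 2]. *)
pose E S x := ric (F x) (P x) (Q x) S - ric F0 P0 Q0 S.
have small S : S^t* = S -> \forall x \near Fl, psd ((t / 2)%:C%C *: 1%:M + E S x) /\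
    psd ((t / 2)%:C%C *: 1%:M - E S x).
  move=> hS.
  have hE x : (E S x)^t* = E S x.
    by rewrite adjmxB (ric_adj (F x) (pP x) (pQ x) hS) (ric_adj F0 pP0 pQ0 hS).
  have E0 : mxcvg Fl (E S) 0.
    rewrite -(subrr (ric F0 P0 Q0 S)); apply: mxcvgB; last exact: mxcvg_cst.
    by apply: mxcvg_ric => //; exact: mxcvg_cst.
  have t2 : 0 < t / 2 by rewrite divr_gt0.
  have near_t : \forall x \near Fl, sumnorm (E S x) < (t / 2)%:C%C.
    by apply: ccvg_near_lt (ccvg_sumnorm E0) _ t2 => x; exact: sumnorm_ge0.
  apply: filterS near_t => x /ltW le_t; rewrite -subr_ge0 in le_t.
  split.
    have -> : (t / 2)%:C%C *: 1%:M + E S x =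
      ((t / 2)%:C%C - sumnorm (E S x)) *: 1%:M + ((sumnorm (E S x))%:M + E S x).
      by rewrite -[(sumnorm _)%:M]scalemx1; apply/matrixP=> i j; rewrite !mxE; ring.
    by apply: psdD; [exact: psdZ le_t (psd1 n) | exact: psd_sumnorm].
  have -> : (t / 2)%:C%C *: 1%:M - E S x =
    ((t / 2)%:C%C - sumnorm (E S x)) *: 1%:M + ((sumnorm (- E S x))%:M - E S x).
    by rewrite sumnormN -[(sumnorm _)%:M]scalemx1; apply/matrixP=> i j; rewrite !mxE; ring.
  apply: psdD; first exact: psdZ le_t (psd1 n).
  by apply: psd_sumnorm; rewrite adjmxN hE.
have hp : (X0 + tC *: Z)^t* = X0 + tC *: Z by rewrite adjmxD adjmxZ tCr pX0.1 hZ.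
have hm : (X0 - tC *: Z)^t* = X0 - tC *: Z by rewrite adjmxB adjmxZ tCr pX0.1 hZ.
have t2C : (t / 2)%:C%C = tC / 2 by rewrite rmorphM fmorphV rmorph_nat.
have near_p : \forall x \near Fl, psd ((t / 2)%:C%C *: 1%:M - E (X0 + tC *: Z) x).
  by apply: filterS (small _ hp) => y [_ h]; exact: h.
have near_m : \forall x \near Fl, psd ((t / 2)%:C%C *: 1%:M + E (X0 - tC *: Z) x).
  by apply: filterS (small _ hm) => y [h _]; exact: h.
apply: filterS2 near_p near_m => x psd_p psd_m; split.
  apply: (ric_le (pP x) (pQ x) (@cFP x)); last by rewrite ricX; exact: psd0.
  - exact: psdD pX0 (psdZ (ltW tC0) pZ).
  2: exact: (pX x).1.
  have -> : - ric (F x) (P x) (Q x) (X0 + tC *: Z) = (t / 2)%:C%C *: 1%:M +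
    tC ^+ 2 *: (Z *m Q0 *m Z) + ((t / 2)%:C%C *: 1%:M - E (X0 + tC *: Z) x).
    by rewrite /E ricD // t2C; apply/matrixP=> i j; rewrite !mxE; field.
  apply: psdD; last exact: psd_p.
  apply: psdD; last exact: psdZ (exprn_ge0 _ (ltW tC0)) pZQZ.
  by apply: psdZ (psd1 n); rewrite t2C divr_ge0 ?ler0n // ltW.
apply: (ric_le (pP x) (pQ x) (@cFP x)); [exact: pX | rewrite ricX; exact: pN0 | exact: hm |].
have -> : ric (F x) (P x) (Q x) (X0 - tC *: Z) = 
  (tC / 2 - tC ^+ 2 * sumnorm (Z *m Q0 *m Z)) *: 1%:M +
    tC ^+ 2 *: ((sumnorm (- (Z *m Q0 *m Z)))%:M - (Z *m Q0 *m Z)) +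
    ((t / 2)%:C%C *: 1%:M + E (X0 - tC *: Z) x).
  rewrite /E -scaleNr ricD; last by rewrite rmorphN; congr (- _); exact: tCr.
  rewrite sumnormN t2C -[(sumnorm _)%:M]scalemx1.
  by apply/matrixP=> i j; rewrite !mxE; field.
apply: psdD; last exact: psd_m.
apply: psdD; last first.
  apply: psdZ (exprn_ge0 _ (ltW tC0)) _.
  by apply: psd_sumnorm; rewrite adjmxN pZQZ.1.
apply: psdZ (psd1 n).
by rewrite subr_ge0 ec -t2C -rmorphXn -rmorphM lecR.
Qed.

Lemma riccati_solution_cvg : mxcvg Fl X X0.
Proof.
have [Z pZ [t0 t0_gt0 H]] := riccati_sandwich.
apply: mxcvg_quadform => u.
have im0 x : complex.Im (quadform (X x) u) = 0 by apply/ger0_Im/(pX x).2.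
split; last first.
  under eq_fun do rewrite im0.
  by rewrite (ger0_Im (pX0.2 u)); exact: cvg_cst.
apply/cvgrPdist_le => e e0.
pose z := complex.Re (quadform Z u).
have z0 : 0 <= z by exact/ge0_Re/pZ.2.
(* The enclosure has half-width [t * z] at [u]; [z + 1] replaces [z], which may vanish. *)
pose t := Num.min t0 (e / (z + 1)).
have z1 : 0 < z + 1 by rewrite ltr_wpDl.
have t_gt0 : 0 < t by rewrite lt_min t0_gt0 divr_gt0.
have tz : t * z <= e.
  apply: (@le_trans _ _ (e / (z + 1) * (z + 1))); last by rewrite divfK ?gt_eqF.
  apply: ler_pM => //; [exact: ltW | by rewrite ge_min lexx orbT | by rewrite lerDl].
apply: filterS (H t t_gt0 _); last by rewrite ge_min lexx.
move=> x [[_ /(_ u) h1] [_ /(_ u) h2]].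
apply: le_trans tz; rewrite distrC ler_norml.
move/ge0_Re: h1; move/ge0_Re: h2.
rewrite !(quadformD, quadformN, quadformZ) !(ReD, ReN, ReZ) -/z.
move: (complex.Re (quadform X0 u)) (complex.Re (quadform (X x) u)) (t * z).
by move=> a b d h1 h2; apply/andP; split; lra.
Qed.

End Stability.

(** * Operator norm and positive definiteness *)

Section OperatorNorm.
Local Open Scope classical_set_scope.
Context {R : realType}.
Local Notation normc := (@Normc.normc R).

Lemma normc_norm (z : R[i]) : `|z| = (normc z)%:C%C.
Proof. by rewrite normc_def; case: z. Qed.

Lemma normc_ge0 (z : R[i]) : 0 <= normc z.
Proof. by rewrite -lecR -normc_norm; exact: normr_ge0. Qed.

Lemma normc_le_l2norm n (v : 'cV[R[i]]_n) i : normc (v i 0) <= l2norm v.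
Proof.
rewrite -[leLHS]ger0_norm ?normc_ge0 // -sqrtr_sqr ler_wsqrtr // (bigD1 i) //=.
by rewrite lerDl sumr_ge0 // => j _; apply: sqr_ge0.
Qed.

Lemma l2norm_le_sum n (v : 'cV[R[i]]_n) : l2norm v <= \sum_i normc (v i 0).
Proof.
have s0 : 0 <= \sum_i normc (v i 0) by apply: sumr_ge0 => i _; exact: normc_ge0.
rewrite -[leRHS]ger0_norm // -sqrtr_sqr ler_wsqrtr //.
rewrite expr2 mulr_suml; apply: ler_sum => i _; rewrite expr2.
apply: ler_wpM2l; first exact: normc_ge0.
by rewrite (bigD1 i) //= lerDl sumr_ge0 // => j _; exact: normc_ge0.
Qed.

(** This also shows that the set whose [sup] defines [opnorm] is bounded, as [ub_le_sup]
    requires. *)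
Lemma l2norm_mul_le m n (M : 'M[R[i]]_(m, n)) v :
  l2norm v <= 1 -> ((l2norm (M *m v))%:C <= sumnorm M)%C.
Proof.
move=> v1; apply: (@le_trans _ _ (\sum_i normc ((M *m v) i 0))%:C%C).
  by rewrite lecR l2norm_le_sum.
rewrite rmorph_sum; apply: ler_sum => i _; rewrite /= -normc_norm mxE.
apply: le_trans (ler_norm_sum _ _ _) _; apply: ler_sum => j _.
rewrite normrM ler_piMr // normc_norm (lecR _ 1).
exact: le_trans (normc_le_l2norm _ _) v1.
Qed.

Lemma l2norm0 n : l2norm (0 : 'cV[R[i]]_n) = 0.
Proof. by rewrite /l2norm big1 ?sqrtr0 // => i _; rewrite mxE Normc.normc0 expr0n. Qed.

Lemma opnorm_le_sumnorm m n (M : 'M[R[i]]_(m, n)) : ((opnorm M)%:C <= sumnorm M)%C.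
Proof.
have [c c0 ec] := sumnorm_real M.
rewrite ec lecR; apply: ge_sup.
  by exists (l2norm (M *m 0)), 0; rewrite //= l2norm0.
by move=> _ [v v1 <-]; rewrite -lecR -ec; apply: l2norm_mul_le.
Qed.

Lemma l2norm_mul_le_opnorm m n (M : 'M[R[i]]_(m, n)) v :
  l2norm v <= 1 -> l2norm (M *m v) <= opnorm M.
Proof.
move=> v1; apply: ub_le_sup; last by exists v.
have [c c0 ec] := sumnorm_real M; exists c => _ [w w1 <-].
by rewrite -lecR -ec; apply: l2norm_mul_le.
Qed.

Lemma normc_le_opnorm m n (M : 'M[R[i]]_(m, n)) i j : normc (M i j) <= opnorm M.
Proof.
apply: (@le_trans _ _ (l2norm (M *m delta_mx j 0))).
  by rewrite -colE; have := normc_le_l2norm (col j M) i; rewrite mxE.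
apply: l2norm_mul_le_opnorm; apply: le_trans (l2norm_le_sum _) _.
rewrite (bigD1 j) //= big1 => [|k /negPf kj]; rewrite !mxE ?kj ?Normc.normc0 //.
by rewrite !eqxx Normc.normc1 addr0.
Qed.

Lemma opnorm_ge0 m n (M : 'M[R[i]]_(m, n)) : 0 <= opnorm M.
Proof.
apply: le_trans (l2norm_mul_le_opnorm M (_ : l2norm 0 <= 1)); last by rewrite l2norm0.
exact: sqrtr_ge0.
Qed.

Context {T : Type} {F : set_system T} {FF : Filter F}.

Lemma mxcvg_opnorm m n (G : T -> 'M[R[i]]_(m, n)) L :
  (forall e : R, 0 < e -> \forall x \near F, opnorm (L - G x) < e) -> mxcvg F G L.
Proof.
move=> h i j; split; apply/cvgrPdist_lt => e e0; apply: filterS (h e e0) => x lte;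
  apply: le_lt_trans lte; apply: le_trans (normc_le_opnorm _ i j); rewrite !mxE;
  case: (L i j) (G x i j) => [a b] [c d]; rewrite /= -sqrtr_sqr ler_wsqrtr //.
  by rewrite lerDl sqr_ge0.
by rewrite lerDr sqr_ge0.
Qed.

Lemma mxcvg_near_opnorm m n (G : T -> 'M[R[i]]_(m, n)) L (e : R) : 0 < e ->
  mxcvg F G L -> \forall x \near F, opnorm (L - G x) < e.
Proof.
move=> e0 GL.
have LG0 : mxcvg F (fun x => L - G x) 0.
  by rewrite -(subrr L); apply: mxcvgB => //; exact: mxcvg_cst.
have h : \forall x \near F, sumnorm (L - G x) < e%:C%C.
  by apply: ccvg_near_lt (ccvg_sumnorm LG0) _ e0 => x; exact: sumnorm_ge0.
apply: filterS h => x; rewrite -ltcR; apply: le_lt_trans.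
exact: opnorm_le_sumnorm.
Qed.

End OperatorNorm.

Section PositiveDefinite.
Context {R : realType} {n : nat}.
Implicit Types X : 'M[R[i]]_n.

Lemma posdefmx_psd X : posdefmx X -> psd X.
Proof.
move=> [/hermsymmxP hX pos].
have [U [d [UU UU' eX dr]]] := spectral_decomposition hX.
rewrite eX; apply: psd_congr; split=> [|u].
  rewrite tr_diag_mx map_diag_mx; congr diag_mx; apply/matrixP=> a b.
  by rewrite ord1 !mxE; apply/CrealP.
rewrite /quadform -mulmxA mxE sumr_ge0 // => i _; rewrite mul_diag_mx !mxE.
rewrite mulrCA -normCKC mulr_ge0 ?exprn_ge0 //; apply/ltW/pos.
(* Eigenvectors are rows here: the [i]-th row of [U], nonzero since [U U^t* = 1]. *)
apply/eigenvalueP; exists (row i U).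
  rewrite {1}eX !mulmxA -row_mul UU -[_ *m diag_mx d]row_mul mul1mx.
  by rewrite row_diag_mx -scalemxAl -rowE.
apply/eqP => Ui; have := congr1 (fun M => (row i M) 0 i) UU.
by rewrite /= row_mul Ui mul0mx !mxE eqxx => /esym/eqP; rewrite oner_eq0.
Qed.

Lemma psd_posdefmx X : psd X -> X \in unitmx -> posdefmx X.
Proof.
move=> pX uX; split; first exact/hermsymmxP/pX.1.
move=> a /eigenvalueP[v vX v0].
have a0 : a != 0.
  apply: contra v0 => /eqP a0; move: vX; rewrite a0 scale0r.
  by move/(congr1 (mulmx^~ (invmx X))); rewrite mulmxK // mul0mx => ->.
have q0 : 0 < quadform 1%:M (v^t*).
  rewrite lt_def quadform1_ge0 andbT; apply: contra v0 => /eqP/quadform1_eq0 h.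
  by rewrite -[v]trmxCK h adjmx0.
have := pX.2 (v^t*).
have -> : quadform X (v^t*) = a * quadform 1%:M (v^t*).
  by rewrite /quadform trmxCK vX mulmx1 -scalemxAl mxE.
by rewrite pmulr_lge0 // lt_def a0.
Qed.

End PositiveDefinite.

(** * The recovery procedure *)

Section Recovery.
Context {R : realType} {n m1 m2 : nat}.
Implicit Types (A X : 'M[R[i]]_n) (B : 'M[R[i]]_(n, m2)) (C : 'M[R[i]]_(m1, n)).

Lemma riccatiE A B C X :
  riccati A B C X <-> ric ('i *: A) (B *m B^t*) (C^t* *m C) X = 0.
Proof.
suff e : ric ('i *: A) (B *m B^t*) (C^t* *m C) X =
    - (X *m C^t* *m C *m X - 'i *: (A *m X - X *m A^t*) - B *m B^t*).
  by rewrite /riccati e; split=> [->|/eqP]; rewrite ?oppr0 // oppr_eq0 => /eqP.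
by rewrite /ric adjmxZ conjCi; mxring.
Qed.

Lemma psd_gram_adj B : psd (B *m B^t*).
Proof. by have := psd_gram (B^t*); rewrite trmxCK. Qed.

Variables (phi : ratmx R m1 m2) (A : 'M[R[i]]_n) (B : 'M[R[i]]_(n, m2)).
Variable C : 'M[R[i]]_(m1, n).
Hypothesis min : minimal_realization phi A B C.

Lemma riccati_sol_spec : [/\ psd (riccati_sol A B C), riccati_sol A B C \in unitmx &
  ric ('i *: A) (B *m B^t*) (C^t* *m C) (riccati_sol A B C) = 0].
Proof.
have cAB := minimal_riccati_controllable min.
have oAC := minimal_riccati_observable min.
have pP := psd_gram_adj B; have pQ := psd_gram C.
have pN0 : psd (- 0 : 'M[R[i]]_n) by rewrite oppr0; exact: psd0.
have unitX X : psd X -> ric ('i *: A) (B *m B^t*) (C^t* *m C) X = 0 -> X \in unitmx.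
  by move=> pX eX; apply: (supersolution_unit pP pQ cAB pX); rewrite eX; exact: pN0.
have [X [pX eX]] := riccati_solution_exists pP pQ cAB oAC.
(* Existence ensures that [xget] returns a positive solution and not its default [0]. *)
have [] := @xgetPex _ 0 [set X | posdefmx X /\ riccati A B C X]%classic.
  by exists X; split; [exact: psd_posdefmx (unitX _ pX eX) | exact/riccatiE].
move=> /posdefmx_psd pS /riccatiE eS.
split; [exact: pS | exact: unitX pS eS | exact: eS].
Qed.

End Recovery.

Theorem corollary4p4 (R : realType) (n m1 m2 : nat)
    (A : 'M[R[i]]_n) (B : 'M[R[i]]_(n, m2)) (C : 'M[R[i]]_(m1, n))
    (phi : ratmx R m1 m2) :
  strictly_proper phi ->
  minimal_realization phi A B C ->
  forall eps : R, 0 < eps ->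
  exists delta : R, 0 < delta /\
    forall (A' : 'M[R[i]]_n) (B' : 'M[R[i]]_(n, m2)) (C' : 'M[R[i]]_(m1, n))
      (phi' : ratmx R m1 m2),
    minimal_realization phi' A' B' C' ->
    opnorm (A - A') + opnorm (B - B') + opnorm (C - C') < delta ->
    opnorm (rec_alpha A B C - rec_alpha A' B' C')
    + opnorm (rec_S0 A B C - rec_S0 A' B' C')
    + opnorm (rec_theta1 A B C - rec_theta1 A' B' C')
    + opnorm (rec_theta2 B - rec_theta2 B') < eps.
Proof.
move=> _ min eps eps0.
(* Only minimal triples are points, so that positivity, controllability and invertibility hold at
   every point, as the convergence lemmas require. *)
pose triple : Type := {x : 'M[R[i]]_n * 'M[R[i]]_(n, m2) * 'M[R[i]]_(m1, n) |
  exists phi', minimal_realization phi' x.1.1 x.1.2 x.2}.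
pose tA (x : triple) := (sval x).1.1.
pose tB (x : triple) := (sval x).1.2.
pose tC (x : triple) := (sval x).2.
pose dist x := opnorm (A - tA x) + opnorm (B - tB x) + opnorm (C - tC x).
(* The trace on [triple] of the neighborhoods of the given data: a property holds near [Fl] exactly
   when some [delta] guarantees it. *)
pose Fl : set_system triple :=
  filter_from [set d : R | 0 < d]%classic (fun d => [set x | dist x < d]%classic).
have FF : Filter Fl.
  apply: filter_from_filter; first by exists 1; exact: ltr01.
  move=> d e d0 e0; exists (Num.min d e); first by rewrite /= lt_min d0.
  by move=> x; rewrite /= lt_min => /andP[].
have near_dist (d : R) : 0 < d -> \forall x \near Fl, dist x < d by move=> d0; exists d.
have cA : mxcvg Fl tA A.
  apply: mxcvg_opnorm => e /near_dist; apply: filterS => x; apply: le_lt_trans.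
  by rewrite /dist -addrA lerDl addr_ge0 ?opnorm_ge0.
have cB : mxcvg Fl tB B.
  apply: mxcvg_opnorm => e /near_dist; apply: filterS => x; apply: le_lt_trans.
  by rewrite /dist addrAC lerDr addr_ge0 ?opnorm_ge0.
have cC : mxcvg Fl tC C.
  apply: mxcvg_opnorm => e /near_dist; apply: filterS => x; apply: le_lt_trans.
  by rewrite /dist lerDr addr_ge0 ?opnorm_ge0.
pose tX x := riccati_sol (tA x) (tB x) (tC x).
have tmin x : exists phi', minimal_realization phi' (tA x) (tB x) (tC x) := svalP x.
have tspec x := let: ex_intro _ m := tmin x in riccati_sol_spec m.
have [pX uX eX] := riccati_sol_spec min.
have tc x : controllable ('i *: tA x) (tB x *m (tB x)^t*).
  by have [phi' m] := tmin x; exact: minimal_riccati_controllable m.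
have pX' x : psd (tX x) by case: (tspec x).
have uX' x : tX x \in unitmx by case: (tspec x).
have eX' x : ric ('i *: tA x) (tB x *m (tB x)^t*) ((tC x)^t* *m tC x) (tX x) = 0.
  by case: (tspec x).
have ci := @ccvg_cst R triple Fl FF 'i.
have cBB : mxcvg Fl (fun x => tB x *m (tB x)^t*) (B *m B^t*).
  by apply: mxcvgM cB (mxcvg_adj cB).
have cX : mxcvg Fl tX (riccati_sol A B C).
  apply: (riccati_solution_cvg (fun x => psd_gram_adj (tB x))
    (fun x => psd_gram (tC x)) pX' tc eX' (psd_gram_adj B) (psd_gram C) pX
    (minimal_riccati_controllable min) eX (mxcvgZ ci cA) cBB).
  exact: mxcvgM (mxcvg_adj cC) cC.
have e4 : 0 < eps / 4 by rewrite divr_gt0 // ltr0n.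
have n1 : \forall x \near Fl,
    opnorm (rec_alpha A B C - rec_alpha (tA x) (tB x) (tC x)) < eps / 4.
  apply: mxcvg_near_opnorm e4 _; apply: mxcvgD (mxcvgN cA) _.
  exact: mxcvgZ ci (mxcvgM cBB (mxcvg_inv uX uX' cX)).
have n2 : \forall x \near Fl,
    opnorm (rec_S0 A B C - rec_S0 (tA x) (tB x) (tC x)) < eps / 4.
  exact: mxcvg_near_opnorm e4 cX.
have n3 : \forall x \near Fl,
    opnorm (rec_theta1 A B C - rec_theta1 (tA x) (tB x) (tC x)) < eps / 4.
  exact: mxcvg_near_opnorm e4 (mxcvgM cX (mxcvg_adj cC)).
have n4 : \forall x \near Fl, opnorm (rec_theta2 B - rec_theta2 (tB x)) < eps / 4.
  exact: mxcvg_near_opnorm e4 (mxcvgZ ci cB).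
have [d d0 hd] := filterI (filterI n1 n2) (filterI n3 n4).
exists d; split=> // A' B' C' phi' min' lt_d.
have [[/= h1 h2] [h3 h4]] := hd (exist _ (A', B', C') (ex_intro _ phi' min')) lt_d.
have -> : eps = eps / 4 + eps / 4 + eps / 4 + eps / 4 by field.
exact: ltrD (ltrD (ltrD h1 h2) h3) h4.
Qed.
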